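(* Let $d\ge1$ be an integer and let $p(n)=\frac{C\log n}{n^d}$, where $C>d!$ is a constant. Then asymptotically almost surely the hypergraph $G^{d+1}(n,p)$ is connected; that is, $\mathbb{P}[G^{d+1}(n,p(n))\text{ is connected}]\to1$ as $n\to\infty$.
   Context: $G^{d+1}(n,p)$ is the random $(d+1)$-uniform hypergraph on $n$ labelled vertices in which each of the $\binom{n}{d+1}$ potential edges ($(d+1)$-element vertex sets) is present with probability $p$, independently of the others. *)

(* Defs.v *)
From mathcomp Require Import all_boot all_order all_algebra.
From mathcomp Require Import all_classical all_reals all_analysis.

Set Implicit Arguments.
Unset Strict Implicit.
Unset Printing Implicit Defensive.

Import Order.TTheory GRing.Theory Num.Theory.
Import numFieldNormedType.Exports.

Local Open Scope ring_scope.

Section Hypergraph.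
Variable V : finType.

Definition potential_edges (k : nat) : {set {set V}} :=
  [set e : {set V} | #|e| == k].

(* A k-uniform hypergraph with vertex set V is identified with its edge set. *)
Definition uniform_hypergraphs (k : nat) : {set {set {set V}}} :=
  powerset (potential_edges k).

Definition hadj (H : {set {set V}}) : rel V :=
  fun x y => [exists e in H, (x \in e) && (y \in e)].

(* Any two vertices, including isolated ones, are joined by a walk in which
   consecutive vertices lie in a common edge. *)
Definition hypergraph_connected (H : {set {set V}}) : bool :=
  [forall x, forall y, connect (hadj H) x y].

End Hypergraph.

(* The law of G^k(n, p): every potential edge is present with probability p and
   absent with probability 1 - p, independently, whence the product.  It is a
   probability distribution only for 0 <= p <= 1. *)
Definition Gnp_weight (R : realType) (n k : nat) (p : R)
    (H : {set {set 'I_n}}) : R :=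
  \prod_(e in potential_edges 'I_n k) (if e \in H then p else 1 - p).

Definition Gnp_prob (R : realType) (n k : nat) (p : R)
    (A : pred {set {set 'I_n}}) : R :=
  \sum_(H in uniform_hypergraphs 'I_n k | A H) Gnp_weight k p H.

(* Main.v *)
Require Import Defs.
From mathcomp Require Import all_boot all_order all_algebra.
From mathcomp Require Import all_classical all_reals all_analysis.
From mathcomp Require Import ring lra zify.

Import Order.TTheory GRing.Theory Num.Theory.
Import numFieldNormedType.Exports.

Local Open Scope ring_scope.

(** A disconnected hypergraph has a nonempty union S of components with at most
n / 2 vertices, and none of its edges crosses between S and its complement. The
proof is a union bound over S that only looks at the crossing edges having
exactly one vertex in S. There are k * 'C(n - k, d) of them when #|S| = k
([card_singly_crossing_edges]), and by independence they are all absent with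
probability (1 - p) ^+ (k * 'C(n - k, d)) ([sum_avoiding_weights]), so the
probability of being disconnected is at most the sum of these numbers over S
([Gnp_prob_connected_bounds]).

As 1 - p <= expR (- p) and 'C(n - k, d) is at least (t n)^d / d! as soon as
n - k >= t n + d, each term is at most (n^(- (C / d!) t^d))^k. Fix e > 0 with
a := (C / d!) (1 - e)^d > 1, which C > d! permits. If k <= e n / 2, take
t = 1 - e: the term is at most (n^(- a))^k, and summing over nonempty S gives
at most (1 + n^(- a))^n - 1 <= exp (n^(1 - a)) - 1, which tends to 0. If
k > e n / 2, take t = 1 / 4: since k is linear in n, the term is at most
(n^(- c))^n for some c > 0, small enough to beat the 2^n choices of S.
[isolation_dichotomy] is this case split, and [sum_nonempty_subsets_le] sums
both bounds at once. *)

(** * Independence of the edges *)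

(** The hypergraphs that avoid X carry the weight (1 - p)^#|X|: the total weight
of a product measure factors over the elements of E, a factor p + (1 - p) for
each free element and a factor 1 - p for each forbidden one. *)
Lemma sum_avoiding_weights {R : comNzRingType} {T : finType} (p : R)
    (E X : {set T}) : X \subset E ->
  \sum_(H in powerset E | [disjoint H & X])
     \prod_(e in E) (if e \in H then p else 1 - p) = (1 - p) ^+ #|X|.
Proof.
move=> XE.
(* F and G weigh presence and absence on the whole type, so that expanding the
   product of the F e + G e gives a sum over all subsets of T; the value 0 of F
   off E :\: X kills the subsets that should not be counted. *)
pose F e := if e \in E :\: X then p else 0.
pose G e := if e \in E then 1 - p else 1.
have -> : (1 - p) ^+ #|X| = \prod_e (F e + G e).
  rewrite (bigID (mem X)) /= [X in _ * X]big1 ?mulr1.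
    rewrite -prodr_const; apply: eq_bigr => e eX.
    by rewrite /F /G inE eX (fintype.subsetP XE) //= add0r.
  move=> e eX; rewrite /F /G inE eX /=; case: ifP => _; last by rewrite add0r.
  by rewrite addrC subrK.
rewrite bigA_distr [RHS](bigID (fun H : {set T} => H \subset E :\: X)) /=.
rewrite [X in _ = _ + X]big1 ?addr0; last first.
  move=> H /= /fintype.subsetPn[e eH eN].
  by rewrite (bigD1 e) //= eH /F (negbTE eN) mul0r.
apply: eq_big => [H|H]; first by rewrite powersetE finset.subsetD.
rewrite powersetE -finset.subsetD => HEX; rewrite [RHS](bigID (mem E)) /=.
rewrite [X in _ * X]big1 ?mulr1 => [|e eE].
  apply: eq_bigr => e eE; rewrite /F /G eE.
  by case: ifP => // eH; rewrite (fintype.subsetP HEX).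
rewrite /G (negbTE eE); case: ifP => // eH.
by move: (fintype.subsetP HEX _ eH); rewrite inE (negbTE eE) andbF.
Qed.

(** * Edges with exactly one vertex in a given set *)

(** Only these crossing edges are used: they are easy to count, and when S is
small compared with V nearly every crossing edge is of this kind. *)
Definition singly_crossing_edges {V : finType} (d : nat) (S : {set V}) :
    {set {set V}} :=
  [set u.1 |: u.2 | u in
    finset.setX S [set T : {set V} | T \subset ~: S & #|T| == d]].

Lemma card_singly_crossing_edges {V : finType} (d : nat) (S : {set V}) :
  #|singly_crossing_edges d S| = (#|S| * 'C(#|V| - #|S|, d))%N.
Proof.
(* The pair (x, T) is read off the edge as its traces on S and ~: S. *)
have trace x (T : {set V}) : x \in S -> T \subset ~: S ->
    (x |: T) :&: S = [set x] /\ (x |: T) :\: S = T.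
  move=> xS TS; have TS0 : T :&: S = finset.set0.
    by apply/eqP; rewrite finset.setI_eq0 finset.disjoints_subset.
  split.
    rewrite finset.setIUl TS0 finset.setU0.
    by apply/finset.setIidPl; rewrite finset.sub1set.
  rewrite finset.setDUl (_ : [set x] :\: S = finset.set0).
    by rewrite finset.set0U finset.setDE; apply/finset.setIidPl.
  by apply/eqP; rewrite finset.setD_eq0 finset.sub1set.
rewrite card_in_imset => [|[x T] [y U]].
  by rewrite cardsX cards_draws [#|~: S|]cardsCs finset.setCK.
rewrite !inE /= => /andP[xS /andP[TS _]] /andP[yS /andP[US _]] eq.
have [ax bT] := trace _ _ xS TS; have [ay bU] := trace _ _ yS US.
congr (_, _); last by rewrite -bT -bU eq.
by apply: finset.set1_inj; rewrite -ax -ay eq.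
Qed.

Lemma singly_crossing_edges_sub {V : finType} (d : nat) (S : {set V}) :
  singly_crossing_edges d S \subset potential_edges V d.+1.
Proof.
apply/fintype.subsetP => e /imsetP[[x T]]; rewrite inE /= => /andP[xS].
rewrite inE => /andP[TS /eqP cT] ->; rewrite inE cardsU1 cT.
case: (boolP (x \in T)) => // xT.
by move: (fintype.subsetP TS _ xT); rewrite inE xS.
Qed.

Lemma hadj_sym {V : finType} (H : {set {set V}}) : symmetric (hadj H).
Proof. by move=> x y; apply: eq_existsb => e; rewrite (andbC (x \in e)). Qed.

(** A connected component and its complement are both closed under adjacency,
so no edge of H crosses between them, and the smaller of the two is the
required set. The hypothesis 0 < d makes an edge with one vertex in S reach a
second vertex, outside S. *)
Lemma disconnected_avoids_singly_crossing {V : finType} (d : nat)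
    (H : {set {set V}}) :
  (0 < d)%N -> ~~ hypergraph_connected H ->
  exists2 S : {set V}, (0 < #|S|)%N && (#|S|.*2 <= #|V|)%N &
    [disjoint H & singly_crossing_edges d S].
Proof.
move=> d0 /forallPn[x /forallPn[y nxy]].
pose K := [set z | connect (hadj H) x z].
have closed_split u v : hadj H u v -> (u \in K) = (v \in K).
  move=> uv; rewrite !inE; apply/idP/idP => h; apply: (connect_trans h);
    by apply: connect1; rewrite // hadj_sym.
have key (S : {set V}) : (forall u v, hadj H u v -> (u \in S) = (v \in S)) ->
    [disjoint H & singly_crossing_edges d S].
  move=> Scl; rewrite finset.disjoints_subset; apply/fintype.subsetP => e eH.
  rewrite inE; apply/negP => /imsetP[[u T]]; rewrite inE /= => /andP[uS].
  rewrite inE => /andP[TS /eqP cT] eE.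
  have /card_gt0P[v vT] : (0 < #|T|)%N by rewrite cT.
  have uv : hadj H u v.
    by apply/existsP; exists e; rewrite eH eE !inE eqxx vT orbT.
  by move: (fintype.subsetP TS _ vT); rewrite inE -(Scl _ _ uv) uS.
have K0 : (0 < #|K|)%N by apply/card_gt0P; exists x; rewrite inE connect0.
have KC0 : (0 < #|~: K|)%N by apply/card_gt0P; exists y; rewrite !inE.
have KKC := cardsC K.
have [le|lt] := leqP #|K|.*2 #|V|.
  by exists K; [rewrite K0 | exact: key].
exists (~: K); first by rewrite KC0 -KKC; lia.
by apply: key => u v uv; rewrite !finset.in_setC (closed_split _ _ uv).
Qed.

(** The union bound over the sets S of [disconnected_avoids_singly_crossing]. *)
Lemma Gnp_prob_connected_bounds {R : realType} (n d : nat) (p : R) :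
  (0 < d)%N -> 0 <= p <= 1 ->
  1 - \sum_(S : {set 'I_n} | (0 < #|S|)%N && (#|S|.*2 <= n)%N)
        (1 - p) ^+ (#|S| * 'C(n - #|S|, d))
    <= Gnp_prob d.+1 p (@hypergraph_connected 'I_n) <= 1.
Proof.
move=> d0 /andP[p0 p1].
have w0 H : 0 <= Gnp_weight (n := n) d.+1 p H.
  by apply: prodr_ge0 => e _; case: ifP => _ //; rewrite subr_ge0.
have tot : \sum_(H in uniform_hypergraphs 'I_n d.+1) Gnp_weight d.+1 p H = 1.
  rewrite -[RHS](expr0 (1 - p)) -(finset.cards0 {set 'I_n}).
  rewrite -(@sum_avoiding_weights _ _ p (potential_edges 'I_n d.+1)) //;
    last exact: finset.sub0set.
  apply: eq_bigl => H; rewrite /uniform_hypergraphs.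
  by rewrite finset.disjoints_subset finset.setC0 finset.subsetT andbT.
rewrite /Gnp_prob.
rewrite (bigID (@hypergraph_connected 'I_n)) /= in tot.
have neg0 : 0 <= \sum_(H in uniform_hypergraphs 'I_n d.+1 |
    ~~ hypergraph_connected H) Gnp_weight d.+1 p H by apply: sumr_ge0.
suff : \sum_(H in uniform_hypergraphs 'I_n d.+1 |
    ~~ hypergraph_connected H) Gnp_weight d.+1 p H
  <= \sum_(S : {set 'I_n} | (0 < #|S|)%N && (#|S|.*2 <= n)%N)
        (1 - p) ^+ (#|S| * 'C(n - #|S|, d)).
  move=> h; apply/andP; split; last by rewrite -[leRHS]tot lerDl.
  by rewrite lerBlDl -[leLHS]tot addrC lerD2r.
have avoid (S : {set 'I_n}) : (1 - p) ^+ (#|S| * 'C(n - #|S|, d)) =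
    \sum_(H in uniform_hypergraphs 'I_n d.+1)
       if [disjoint H & singly_crossing_edges d S]
       then Gnp_weight d.+1 p H else 0.
  rewrite -[n in 'C(n - _, d)]card_ord -card_singly_crossing_edges.
  rewrite -(sum_avoiding_weights p _ _ (singly_crossing_edges_sub d S)).
  by rewrite big_mkcondr.
rewrite (eq_bigr _ (fun S _ => avoid S)).
rewrite exchange_big big_mkcondr; apply: ler_sum => H HE /=.
case: ifPn => [/(disconnected_avoids_singly_crossing _ _ d0)[S Sn HS]|_];
  last first.
  by apply: sumr_ge0 => S _; case: ifP.
rewrite card_ord in Sn; rewrite (bigD1 S) //= HS lerDl.
by apply: sumr_ge0 => S' _; case: ifP => // _; exact: w0.
Qed.

(** * Estimates for a fixed number of vertices *)

Lemma sum_expr_card {R : comNzRingType} {T : finType} (x : R) :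
  \sum_(S : {set T}) x ^+ #|S| = (1 + x) ^+ #|T|.
Proof.
transitivity (\prod_(i : T) (x + 1)); last by rewrite prodr_const addrC.
rewrite bigA_distr; apply: eq_big => // S _.
by rewrite -big_mkcond prodr_const.
Qed.

(** Sums a per-set bound with two regimes: the geometric part x^k sums over the
nonempty sets to (1 + x)^n - 1, and the uniform part z^n is paid at most 2^n
times. *)
Lemma sum_nonempty_subsets_le {R : realFieldType} (n : nat) (q : nat -> R)
    (x z : R) : 0 <= x -> 0 <= z ->
  (forall k, (k.*2 <= n)%N -> q k <= x ^+ k + z ^+ n) ->
  \sum_(S : {set 'I_n} | (0 < #|S|)%N && (#|S|.*2 <= n)%N) q #|S|
    <= ((1 + x) ^+ n - 1) + (2 * z) ^+ n.
Proof.
move=> x0 z0 qle.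
have -> : (1 + x) ^+ n - 1 = \sum_(S : {set 'I_n} | (0 < #|S|)%N) x ^+ #|S|.
  rewrite -[in LHS](card_ord n) -sum_expr_card (bigD1 finset.set0) //=.
  rewrite finset.cards0 expr0 [1 + _]addrC addrK; apply: eq_bigl => S.
  by rewrite card_gt0.
have -> : (2 * z) ^+ n = \sum_(S : {set 'I_n}) z ^+ n.
  rewrite sumr_const exprMn -[in RHS]mulr_natl; congr (_ * _).
  by rewrite -natrX -cardsT -finset.powersetT card_powerset cardsT card_ord.
rewrite [in leRHS]big_mkcond -big_split big_mkcond; apply: ler_sum => S _ /=.
case: ltnP => [S0|_] /=; last by rewrite add0r exprn_ge0.
by case: ifP => [/qle//|_]; rewrite addr_ge0 ?exprn_ge0.
Qed.

(** The falling factorial m (m - 1) ... (m - d + 1) has d factors, each at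
least m - d >= y. *)
Lemma binomial_ge {R : realFieldType} (y : R) (m d : nat) :
  0 <= y -> y + d%:R <= m%:R -> y ^+ d / d`!%:R <= 'C(m, d)%:R.
Proof.
move=> y0 ym; rewrite ler_pdivrMr ?ltr0n ?fact_gt0 //.
rewrite -natrM bin_ffact ffact_prod natr_prod.
rewrite -[X in _ ^+ X]card_ord -prodr_const; apply: ler_prod => i _.
rewrite y0 /= (le_trans _ (_ : m%:R - i%:R <= _)) //.
  rewrite lerBrDr; apply: le_trans ym; rewrite lerD2l ler_nat.
  exact: ltnW.
by rewrite lerBlDr -natrD ler_nat; lia.
Qed.

(** Combines 1 - p <= expR (- p) with p 'C(n - k, d) >= (C / d!) t^d ln n, the
powers of n in p and in the lower bound (t n)^d / d! cancelling. *)
Lemma isolation_bound {R : realType} (n d k : nat) (C t : R) :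
    let p := C * ln (n%:R : R) / n%:R ^+ d in
  (0 < n)%N -> 0 <= C -> 0 <= t -> p <= 1 -> t * n%:R + d%:R <= (n - k)%:R ->
  (1 - p) ^+ (k * 'C(n - k, d))
    <= expR (- (C / d`!%:R * t ^+ d * ln n%:R)) ^+ k.
Proof.
move=> p n0 C0 t0 p1 tn.
have nR : 0 < n%:R :> R by rewrite ltr0n.
have L0 : 0 <= ln (n%:R : R) by rewrite ln_ge0 // ler1n.
rewrite mulnC exprM lerXn2r ?nnegrE ?exprn_ge0 ?subr_ge0 ?expR_ge0 //.
apply: (@le_trans _ _ (expR (- p) ^+ 'C(n - k, d))).
  by rewrite lerXn2r ?nnegrE ?subr_ge0 ?expR_ge0 // expR_ge1Dx.
rewrite -expRM_natr ler_expR mulNr lerN2.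
have := binomial_ge _ _ _ (mulr_ge0 t0 (ltW nR)) tn.
have p0 : 0 <= p by rewrite divr_ge0 ?mulr_ge0 ?exprn_ge0 ?ler0n.
move=> /(ler_wpM2l p0); apply: le_trans; rewrite le_eqVlt; apply/orP; left.
apply/eqP; rewrite /p exprMn; field.
by rewrite pnatr_eq0 -lt0n fact_gt0 expf_neq0 ?lt0r_neq0.
Qed.

(** A set of at most e n / 2 vertices leaves at least (1 - e) n + d outside,
which keeps the exponent sharp; a larger set still leaves n / 4 + d, and the
loss in the exponent is harmless because k is then linear in n. *)
Lemma isolation_dichotomy {R : realType} (n d k : nat) (C e : R) :
    let p := C * ln (n%:R : R) / n%:R ^+ d in
    let b := C / d`!%:R * 4^-1 ^+ d in
  (0 < n)%N -> 0 <= C -> 0 <= e <= 1 -> p <= 1 ->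
  d%:R <= n%:R * (e / 2) -> d%:R * 4 <= n%:R :> R -> (k.*2 <= n)%N ->
  (1 - p) ^+ (k * 'C(n - k, d))
    <= expR (- (C / d`!%:R * (1 - e) ^+ d * ln n%:R)) ^+ k
       + expR (- (b * (e / 2) * ln n%:R)) ^+ n.
Proof.
move=> p b n0 C0 /andP[e0 e1] p1 d_small d_quarter kn.
have L0 : 0 <= ln (n%:R : R) by rewrite ln_ge0 // ler1n.
have b0 : 0 <= b by rewrite mulr_ge0 ?divr_ge0 ?exprn_ge0 ?invr_ge0 ?ler0n.
have kR : (n - k)%:R = n%:R - k%:R :> R.
  by rewrite natrB // (leq_trans _ kn) // -addnn leq_addr.
have k2 : k%:R * 2 <= n%:R :> R by rewrite -natrM ler_nat muln2.
have [k_small|k_large] := leP (k%:R : R) (e / 2 * n%:R).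
  rewrite ler_wpDr ?exprn_ge0 ?expR_ge0 //.
  apply: isolation_bound; rewrite ?subr_ge0 // kR.
  clear -k_small d_small; lra.
rewrite ler_wpDl ?exprn_ge0 ?expR_ge0 //.
apply: (@le_trans _ _ (expR (- (b * ln n%:R)) ^+ k)).
  apply: isolation_bound; rewrite ?invr_ge0 ?ler0n // kR.
  clear -k2 d_quarter; lra.
rewrite -!expRM_natr ler_expR !mulNr lerN2.
have := ler_wpM2l (mulr_ge0 b0 L0) (ltW k_large).
suff -> : b * (e / 2) * ln n%:R * n%:R = b * ln n%:R * (e / 2 * n%:R) by [].
by clear; ring.
Qed.

(** This is where the strict inequality C > d! enters, with c = C / d!. By
Bernoulli's inequality it suffices that c (1 - d e) > 1; the chosen e makes the
left side equal to 1 + (c - 1) / (d + 1). *)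
Lemma exists_slack_pow {R : realFieldType} (d : nat) (c : R) :
  1 < c -> exists2 e : R, 0 < e < 1 & 1 < c * (1 - e) ^+ d.
Proof.
move=> c1; have c0 : 0 < c by lra.
have d0 : 0 < d.+1%:R :> R by rewrite ltr0n.
pose e := (c - 1) / (d.+1%:R * c).
have e0 : 0 < e by rewrite divr_gt0 ?mulr_gt0 // subr_gt0.
have e1 : e < 1.
  rewrite ltr_pdivrMr ?mulr_gt0 // mul1r -natr1 mulrDl mul1r.
  have : 0 <= d%:R * c by rewrite mulr_ge0 ?ler0n ?ltW.
  lra.
exists e; first by rewrite e0.
have eE : e = (c - 1) / (d.+1%:R * c) by [].
move: (e) e0 e1 eE => {}e e0 e1 eE.
have bernoulli m : 1 - m%:R * e <= (1 - e) ^+ m.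
  elim: m => [|m IH]; first by rewrite mul0r subr0 expr0.
  rewrite exprS; apply: (@le_trans _ _ ((1 - e) * (1 - m%:R * e))); last first.
    by rewrite ler_wpM2l // subr_ge0 ltW.
  have : 0 <= m%:R * e * e by rewrite mulr_ge0 ?mulr_ge0 ?ler0n ?ltW.
  rewrite -natr1; lra.
apply: (@lt_le_trans _ _ (c * (1 - d%:R * e))); last first.
  by rewrite ler_wpM2l // ltW.
have -> : c * (1 - d%:R * e) = 1 + (c - 1) / d.+1%:R.
  by rewrite eE -natr1; field; rewrite natr1 !lt0r_neq0.
by rewrite ltrDl divr_gt0 // subr_gt0.
Qed.

(** * Limits *)

Local Open Scope classical_set_scope.
Local Open Scope ring_scope.

Lemma expR_Nln_cvg0 {R : realType} (c : R) : 0 < c ->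
  (fun n : nat => expR (- (c * ln (n%:R : R)))) @ \oo --> (0 : R).
Proof.
move=> c0.
have lnoo : (c * ln (n%:R : R)) @[n --> \oo] --> +oo.
  apply/cvgryPge => A; near=> n.
  have : expR (A / c) <= n%:R by near: n; exact: nbhs_infty_ger.
  rewrite -ler_pdivrMl // mulrC => h.
  by rewrite -[leLHS]expRK ler_ln // posrE ?expR_gt0 //
     (lt_le_trans _ h) ?expR_gt0.
have := @cvgr_expR R.
by move/cvg_pinftyP => /(_ _ lnoo).
Unshelve. all: end_near. Qed.

(** With L = ln n, the bound n = expR L >= 1 + L^2 / 2 exceeds C L once
L >= 2 C. *)
Lemma near_Mln_div_pow_le1 {R : realType} (d : nat) (C : R) :
  (0 < d)%N -> 0 < C ->
  \forall n \near \oo, C * ln (n%:R : R) / n%:R ^+ d <= 1.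
Proof.
move=> d0 C0; near=> n.
have n1 : (1 : R) <= n%:R by near: n; exact: nbhs_infty_ger.
have np : (0 : R) < n%:R by apply: lt_le_trans n1.
rewrite ler_pdivrMr ?exprn_gt0 // mul1r.
apply: (@le_trans _ _ n%:R); last first.
  by rewrite -[leLHS]expr1 ler_weXn2l.
have L0 := ln_ge0 n1.
have L2 : 2 * C <= ln (n%:R : R).
  have : expR (2 * C) <= n%:R by near: n; exact: nbhs_infty_ger.
  by move=> h; rewrite -[leLHS]expRK ler_ln // posrE expR_gt0.
have := expR_ge1Dxn 1 L0; rewrite lnK ?posrE // => h; apply: le_trans h.
have : 2 * C * ln n%:R <= ln n%:R ^+ 2 :> R by rewrite expr2 ler_wpM2r.
rewrite (_ : 2`! = 2)%N //; lra.
Unshelve. all: end_near. Qed.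

Theorem theorem6p1 (R : realType) (d : nat) (C : R)
    (hd : (1 <= d)%N) (hC : (d`!)%:R < C) :
  (fun n : nat => Gnp_prob d.+1 (C * ln (n%:R : R) / n%:R ^+ d)
                    (@hypergraph_connected 'I_n)) @ \oo --> (1 : R).
Proof.
have dfact : 0 < d`!%:R :> R by rewrite ltr0n fact_gt0.
have C0 : 0 < C := lt_trans dfact hC.
have [|e /andP[e0 e1]] := exists_slack_pow d (C / d`!%:R).
  by rewrite ltr_pdivlMr // mul1r.
set a := C / d`!%:R * (1 - e) ^+ d => a1.
pose b : R := C / d`!%:R * 4^-1 ^+ d.
have b0 : 0 < b by rewrite mulr_gt0 ?divr_gt0 // exprn_gt0 // invr_gt0 ltr0n.
pose c := b * (e / 2).
have c0 : 0 < c by rewrite mulr_gt0 // divr_gt0.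
(* z n = n^(- c) and w n = n^(1 - a): small and large sets contribute at most
   expR (w n) - 1 and 2 * z n respectively. *)
pose z n : R := expR (- (c * ln (n%:R : R))).
pose w n : R := expR (- ((a - 1) * ln (n%:R : R))).
have z_cvg : z @ \oo --> (0 : R) := expR_Nln_cvg0 c c0.
have w_cvg : w @ \oo --> (0 : R).
  by apply: expR_Nln_cvg0; rewrite subr_gt0.
apply: (@squeeze_cvgr _ _ _ _ (fun n => 1 - (expR (w n) - 1 + 2 * z n))
          (cst 1)); last exact: cvg_cst; last first.
  have ew : (fun n => expR (w n)) @ \oo --> expR 0.
    exact: (continuous_cvg _ (@continuous_expR R 0) w_cvg).
  have two : (fun=> 2 : R) @ \oo --> (2 : R) by exact: cvg_cst.
  have one : (fun=> 1 : R) @ \oo --> (1 : R) by exact: cvg_cst.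
  have := cvgB one (cvgD (cvgB ew one) (cvgM two z_cvg)).
  by rewrite expR0 subrr mulr0 addr0 subr0; exact.
near=> n.
have n1 : (1 : R) <= n%:R by near: n; exact: nbhs_infty_ger.
have n0 : (0 < n)%N by rewrite -(ltr0n R) (lt_le_trans _ n1).
have L0 := ln_ge0 n1.
set p := C * ln n%:R / n%:R ^+ d.
have p1 : p <= 1 by rewrite /p; near: n; exact: near_Mln_div_pow_le1.
have p0 : 0 <= p by rewrite divr_ge0 ?mulr_ge0 ?exprn_ge0 ?ler0n // ltW.
have d_small : d%:R / (e / 2) <= n%:R by near: n; exact: nbhs_infty_ger.
have d_quarter : d%:R * 4 <= n%:R :> R by near: n; exact: nbhs_infty_ger.
(* Then 2 * z n <= 1, so that its n-th power is at most 2 * z n itself. *)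
have z_small : z n < 2^-1.
  by near: n; apply: (cvgr_lt _ z_cvg); rewrite invr_gt0 ltr0n.
rewrite ler_pdivrMr ?divr_gt0 // in d_small.
pose x := expR (- (a * ln (n%:R : R))).
have term k (kn : (k.*2 <= n)%N) :
    (1 - p) ^+ (k * 'C(n - k, d)) <= x ^+ k + z n ^+ n.
  by apply: isolation_dichotomy; rewrite ?(ltW C0) ?(ltW e0) ?(ltW e1).
have /andP[lo hi] :=
  Gnp_prob_connected_bounds n d p hd (introT andP (conj p0 p1)).
rewrite hi andbT; apply: le_trans lo; rewrite lerD2l lerN2.
have x0 : 0 <= x by exact: expR_ge0.
have z0 : 0 <= z n by exact: expR_ge0.
apply: (le_trans (sum_nonempty_subsets_le n
  (fun k => (1 - p) ^+ (k * 'C(n - k, d))) x (z n) x0 z0 term)).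
apply: lerD.
  rewrite lerD2r.
  have -> : w n = x * n%:R.
    rewrite /x -[X in _ * X]lnK ?posrE ?(lt_le_trans _ n1) // -expRD /w.
    by congr expR; ring.
  rewrite expRM_natr lerXn2r ?nnegrE ?expR_ge0 ?addr_ge0 //.
  exact: expR_ge1Dx.
rewrite -[leRHS]expr1; apply: ler_wiXn2l => //; first by rewrite mulr_ge0.
lra.
Unshelve. all: end_near. Qed.
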